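(* Let $C=C_0+C_1\epsilon\in\mathbb{DQ}^{m\times n}$ and $D=D_0+D_1\epsilon\in\mathbb{DQ}^{k\times n}$. Define $$D_{11}=D_1-D_0C_0^{\dagger}C_1,\quad C_{11}=R_{C_0}C_1,\quad B_3=C_{11}L_{C_0},\quad C_3=D_{11}L_{C_0}.$$ Then the following are equivalent: (1) The dual quaternion matrix equation $XC=D$ is solvable (with $X\in\mathbb{DQ}^{k\times m}$). (2) $D_0L_{C_0}=0$ and $C_3L_{B_3}=0$. (3) $r\begin{bmatrix}C_0 \\ D_0\end{bmatrix}=r(C_0)$ and $r\begin{bmatrix}C_0&0 \\ D_1&D_0 \\ C_1&C_0\end{bmatrix}=r\begin{bmatrix}C_0&0 \\ C_1&C_0\end{bmatrix}$. In this case, the general solution of $XC=D$ can be expressed as $X=X_0+X_1\epsilon$, where $$X_0=D_0C_0^{\dagger}+UR_{C_0},\qquad X_1=(D_{11}-UC_{11})C_0^{\dagger}+U_1R_{C_0},\qquad U=C_3B_3^{\dagger}+U_2R_{B_3},$$ and $U_1,U_2$ are arbitrary matrices over $\mathbb{H}$ of appropriate sizes.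
   Context: $\mathbb{H}$ denotes the real quaternions. The dual quaternions are $\mathbb{DQ}=\{c_0+c_1\epsilon: c_0,c_1\in\mathbb{H}\}$, where $\epsilon^2=0$ and $\epsilon$ commutes with quaternions; addition and multiplication are the resulting ones, e.g. $(a_0+a_1\epsilon)(b_0+b_1\epsilon)=a_0b_0+(a_0b_1+a_1b_0)\epsilon$. A dual quaternion matrix $A\in\mathbb{DQ}^{m\times n}$ is written uniquely as $A=A_0+A_1\epsilon$ with $A_0,A_1\in\mathbb{H}^{m\times n}$, and two such matrices are equal iff their two parts are equal. For a quaternion matrix $M\in\mathbb{H}^{m\times n}$: $r(M)$ is its rank; $M^*$ its conjugate transpose; $M^\dagger$ its Moore-Penrose inverse, i.e. the unique $X$ with $MXM=M$, $XMX=X$, $(MX)^*=MX$, $(XM)^*=XM$; and $L_M=I-M^\dagger M$, $R_M=I-MM^\dagger$. ''The general solution can be expressed as'' means that the solutions are exactly the matrices given by the formula as the arbitrary parameter matrices vary. *)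

(* Defs.v *)
From HB Require Import structures.
From mathcomp Require Import all_boot all_order all_algebra.
From mathcomp Require Import boolp classical_sets reals.
From mathcomp Require Import ring.

Set Implicit Arguments.
Unset Strict Implicit.
Unset Printing Implicit Defensive.

Import GRing.Theory.
Local Open Scope ring_scope.

Record quat (R : realType) := Quat { qre : R; qi : R; qj : R; qk : R }.

Definition quat_tuple (R : realType) (x : quat R) : R * R * R * R :=
  (qre x, qi x, qj x, qk x).
Definition tuple_quat (R : realType) (t : R * R * R * R) : quat R :=
  let: (a, b, c, d) := t in Quat a b c d.

Fact quat_tupleK (R : realType) : cancel (@quat_tuple R) (@tuple_quat R).
Proof. by case. Qed.

HB.instance Definition _ (R : realType) :=
  Choice.copy (quat R) (can_type (@quat_tupleK R)).

Definition quat0 (R : realType) : quat R := Quat 0 0 0 0.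
Definition quat1 (R : realType) : quat R := Quat 1 0 0 0.
Definition quat_opp (R : realType) (x : quat R) : quat R :=
  Quat (- qre x) (- qi x) (- qj x) (- qk x).
Definition quat_add (R : realType) (x y : quat R) : quat R :=
  Quat (qre x + qre y) (qi x + qi y) (qj x + qj y) (qk x + qk y).
Definition quat_mul (R : realType) (x y : quat R) : quat R :=
  let: Quat a b c d := x in
  let: Quat a' b' c' d' := y in
  Quat (a * a' - b * b' - c * c' - d * d')
       (a * b' + b * a' + c * d' - d * c')
       (a * c' - b * d' + c * a' + d * b')
       (a * d' + b * c' - c * b' + d * a').

Fact quat_addA (R : realType) : associative (@quat_add R).
Proof. by move=> x y z; rewrite /quat_add /= !addrA. Qed.

Fact quat_addC (R : realType) : commutative (@quat_add R).
Proof. by move=> x y; congr Quat; rewrite addrC. Qed.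

Fact quat_add0 (R : realType) : left_id (@quat0 R) (@quat_add R).
Proof. by case=> a b c d; rewrite /quat_add /= !add0r. Qed.

Fact quat_addN (R : realType) :
  left_inverse (@quat0 R) (@quat_opp R) (@quat_add R).
Proof. by case=> a b c d; rewrite /quat_add /= !addNr. Qed.

HB.instance Definition _ (R : realType) :=
  GRing.isZmodule.Build (quat R)
    (@quat_addA R) (@quat_addC R) (@quat_add0 R) (@quat_addN R).

Fact quat_mulA (R : realType) : associative (@quat_mul R).
Proof. by case=> ? ? ? ? [? ? ? ?] [? ? ? ?]; congr Quat; ring. Qed.

Fact quat_mul1 (R : realType) : left_id (@quat1 R) (@quat_mul R).
Proof. by case=> ? ? ? ?; congr Quat; ring. Qed.

Fact quat_mulr1 (R : realType) : right_id (@quat1 R) (@quat_mul R).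
Proof. by case=> ? ? ? ?; congr Quat; ring. Qed.

Fact quat_mulDl (R : realType) : left_distributive (@quat_mul R) (@quat_add R).
Proof. by case=> ? ? ? ? [? ? ? ?] [? ? ? ?]; congr Quat => /=; ring. Qed.

Fact quat_mulDr (R : realType) : right_distributive (@quat_mul R) (@quat_add R).
Proof. by case=> ? ? ? ? [? ? ? ?] [? ? ? ?]; congr Quat => /=; ring. Qed.

Fact quat1_neq0 (R : realType) : @quat1 R != @quat0 R.
Proof. by apply/eqP => -[] /eqP; rewrite oner_eq0. Qed.

HB.instance Definition _ (R : realType) :=
  GRing.Zmodule_isNzRing.Build (quat R)
    (@quat_mulA R) (@quat_mul1 R) (@quat_mulr1 R)
    (@quat_mulDl R) (@quat_mulDr R) (@quat1_neq0 R).

Definition conj_quat (R : realType) (x : quat R) : quat R :=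
  Quat (qre x) (- qi x) (- qj x) (- qk x).

(* [Dual a b] is a + b * epsilon with epsilon ^ 2 = 0 and epsilon central. *)
Record dual (K : nzRingType) := Dual { dstd : K; dinf : K }.

Definition dual_pair (K : nzRingType) (x : dual K) : K * K := (dstd x, dinf x).
Definition pair_dual (K : nzRingType) (p : K * K) : dual K := Dual p.1 p.2.

Fact dual_pairK (K : nzRingType) : cancel (@dual_pair K) (@pair_dual K).
Proof. by case. Qed.

HB.instance Definition _ (K : nzRingType) :=
  Choice.copy (dual K) (can_type (@dual_pairK K)).

Definition dual0 (K : nzRingType) : dual K := Dual 0 0.
Definition dual1 (K : nzRingType) : dual K := Dual 1 0.
Definition oppd (K : nzRingType) (x : dual K) : dual K :=
  Dual (- dstd x) (- dinf x).
Definition addd (K : nzRingType) (x y : dual K) : dual K :=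
  Dual (dstd x + dstd y) (dinf x + dinf y).
Definition muld (K : nzRingType) (x y : dual K) : dual K :=
  Dual (dstd x * dstd y) (dstd x * dinf y + dinf x * dstd y).

Fact adddA (K : nzRingType) : associative (@addd K).
Proof. by move=> x y z; rewrite /addd /= !addrA. Qed.

Fact adddC (K : nzRingType) : commutative (@addd K).
Proof. by move=> x y; congr Dual; rewrite addrC. Qed.

Fact add0d (K : nzRingType) : left_id (@dual0 K) (@addd K).
Proof. by case=> a b; rewrite /addd /= !add0r. Qed.

Fact addNd (K : nzRingType) : left_inverse (@dual0 K) (@oppd K) (@addd K).
Proof. by case=> a b; rewrite /addd /= !addNr. Qed.

HB.instance Definition _ (K : nzRingType) :=
  GRing.isZmodule.Build (dual K) (@adddA K) (@adddC K) (@add0d K) (@addNd K).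

Fact muldA (K : nzRingType) : associative (@muld K).
Proof.
by move=> x y z; congr Dual; rewrite /= ?mulrDr ?mulrDl !mulrA ?addrA.
Qed.

Fact mul1d (K : nzRingType) : left_id (@dual1 K) (@muld K).
Proof. by case=> a b; rewrite /muld /= !mul1r mul0r addr0. Qed.

Fact muld1 (K : nzRingType) : right_id (@dual1 K) (@muld K).
Proof. by case=> a b; rewrite /muld /= !mulr1 mulr0 add0r. Qed.

Fact muldDl (K : nzRingType) : left_distributive (@muld K) (@addd K).
Proof. by move=> x y z; congr Dual; rewrite /= !mulrDl // addrACA. Qed.

Fact muldDr (K : nzRingType) : right_distributive (@muld K) (@addd K).
Proof. by move=> x y z; congr Dual; rewrite /= !mulrDr // addrACA. Qed.

Fact dual1_neq0 (K : nzRingType) : @dual1 K != @dual0 K.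
Proof. by apply/eqP => -[] /eqP; rewrite oner_eq0. Qed.

HB.instance Definition _ (K : nzRingType) :=
  GRing.Zmodule_isNzRing.Build (dual K)
    (@muldA K) (@mul1d K) (@muld1 K) (@muldDl K) (@muldDr K) (@dual1_neq0 K).

(* The matrix A0 + A1 * epsilon. *)
Definition dualmx (K : nzRingType) (m n : nat) (A0 A1 : 'M[K]_(m, n)) :
  'M[dual K]_(m, n) := map2_mx (@Dual K) A0 A1.

Definition ctransmx (R : realType) (m n : nat) (M : 'M[quat R]_(m, n)) :
  'M[quat R]_(n, m) := (map_mx (@conj_quat R) M)^T.

(* Scalars act on columns from the right. *)
Definition cols_right_free (K : nzRingType) (m n : nat) (M : 'M[K]_(m, n))
    (S : {set 'I_n}) : Prop :=
  forall a : 'I_n -> K,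
    (forall i, \sum_(j in S) M i j * a j = 0) -> forall j, j \in S -> a j = 0.

(* [\rank] is only available over commutative fields.  Over the quaternions the
   rank is the maximal number of right linearly independent columns. *)
Definition qrank (R : realType) (m n : nat) (M : 'M[quat R]_(m, n)) : nat :=
  \max_(S : {set 'I_n} | `[< cols_right_free M S >]) #|S|.

Definition is_mpinv (R : realType) (m n : nat) (M : 'M[quat R]_(m, n))
    (X : 'M[quat R]_(n, m)) : Prop :=
  [/\ M *m X *m M = M, X *m M *m X = X,
      ctransmx (M *m X) = M *m X & ctransmx (X *m M) = X *m M].

(* Every quaternion matrix has exactly one Moore-Penrose inverse, so the default
   value 0 is never taken. *)
Definition mpinv (R : realType) (m n : nat) (M : 'M[quat R]_(m, n)) :
  'M[quat R]_(n, m) := xget 0 [set X | is_mpinv M X]%classic.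

Definition Lproj (R : realType) (m n : nat) (M : 'M[quat R]_(m, n)) :
  'M[quat R]_n := 1%:M - mpinv M *m M.

Definition Rproj (R : realType) (m n : nat) (M : 'M[quat R]_(m, n)) :
  'M[quat R]_m := 1%:M - M *m mpinv M.

(* Main.v *)
Require Import Defs.
From HB Require Import structures.
From mathcomp Require Import all_boot all_order all_algebra.
From mathcomp Require Import boolp classical_sets reals.
From mathcomp Require Import ring.

Set Implicit Arguments.
Unset Strict Implicit.
Unset Printing Implicit Defensive.

Import GRing.Theory Num.Theory.
Local Open Scope ring_scope.

(** Write [L_A = I - A^+ A] and [R_A = I - A A^+].  Splitting [X = X0 + X1 eps]
    turns [X C = D] into the system [X0 C0 = D0], [X0 C1 + X1 C0 = D1].  All
    that follows rests on the one-sided equation [X A = B]: as soon as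
    [A G A = A], it is consistent exactly when [B (I - G A) = 0], and then its
    solutions are the matrices [B G + U (I - A G)] ([mulmx_eq_inner]).  Applied
    to the first equation this gives [X0] in terms of [U]; applied to the
    second, read as an equation for [X1], it leaves the consistency condition
    [U B3 = C3] ([dual_system_inner]); applied a third time, to [U B3 = C3], it
    gives both the projection conditions and the general solution.

    Of the Penrose equations only [A A^+ A = A] is used, but [mpinv] is defined
    by choice, so a Moore-Penrose inverse has to be shown to exist
    ([exists_mpinv]).  Over any division ring elimination gives an inner inverse
    ([exists_inner_inverse]); inner inverses of [A^* A] and [A A^*] then produce
    the Moore-Penrose inverse, since [A^* A Z = 0] forces [A Z = 0] over the
    quaternions.

    For the rank conditions, adding rows to a matrix leaves its column rank
    unchanged exactly when the kernel does not shrink ([qrank_eq_ker]), which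
    means that the added rows are left combinations of the old ones
    ([qrank_append_rows]).  The second rank condition thus says that the block
    row with entries [D1], [D0] equals the block row with entries [X1], [X0]
    times the block matrix with rows [C0 0] and [C1 C0] for some [X0], [X1].
    This is the system itself, and the first rank condition follows from it. *)

(** * One-sided linear equations and inner inverses *)

Section InnerInverse.

Variable K : nzRingType.

(** The matrix [I - A G] annihilates [A] on the left, and a solution [X] is
    recovered from the formula by the parameter [U = X]. *)
Lemma mulmx_eq_inner (k m n : nat) (A : 'M[K]_(m, n)) (G : 'M[K]_(n, m))
    (B : 'M[K]_(k, n)) (X : 'M[K]_(k, m)) :
  A *m G *m A = A ->
  X *m A = B <->
  B *m (1%:M - G *m A) = 0 /\ exists U, X = B *m G + U *m (1%:M - A *m G).
Proof.
move=> AGA; split=> [<- | [BL [U ->]]].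
  split; first by rewrite -mulmxA mulmxBr mulmx1 mulmxA AGA subrr mulmx0.
  by exists X; rewrite mulmxBr mulmx1 mulmxA addrC subrK.
have RA : (1%:M - A *m G) *m A = 0 by rewrite mulmxBl mul1mx AGA subrr.
rewrite mulmxDl -[U *m _ *m A]mulmxA RA mulmx0 addr0.
by move/eqP: BL; rewrite mulmxBr mulmx1 mulmxA subr_eq0 => /eqP.
Qed.

(** This is a row-by-row elimination.  When a row [a] is put on top of [N],
    which has the inner inverse [G], the remainder [b = a - a G N] is either
    zero, and then [a] imposes nothing new, or has an invertible entry; in the second
    case the corresponding unit vector is corrected to [f] with [N f = 0] and
    [a f = 1], which repairs the first row without disturbing the others. *)
Lemma exists_inner_inverse (m n : nat) (A : 'M[K]_(m, n)) :
  (forall x : K, x != 0 -> exists y, x * y = 1) ->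
  exists G : 'M[K]_(n, m), A *m G *m A = A.
Proof.
move=> invK; elim: m A => [|m IHm] A.
  by exists 0; apply/matrixP => -[].
pose a : 'rV[K]_n := usubmx (A : 'M_(1 + m, n)).
pose N : 'M[K]_(m, n) := dsubmx (A : 'M_(1 + m, n)).
suff : exists G : 'M_(n, 1 + m), col_mx a N *m G *m col_mx a N = col_mx a N.
  by rewrite vsubmxK.
have [G NGN] := IHm N.
pose b := a - a *m G *m N.
have [b0 | bN0] := eqVneq b 0.
  exists (row_mx 0 G).
  rewrite -mulmxA mul_row_col mul0mx add0r mul_col_mx !mulmxA NGN.
  by move/eqP: b0; rewrite subr_eq0 => /eqP <-.
have [j bj] : exists j, b ord0 j != 0.
  apply/existsP; apply: contraNT bN0 => /existsPn b0; apply/eqP/rowP => j.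
  by rewrite [RHS]mxE; apply/eqP; have := b0 j; rewrite negbK.
have [y bjy] := invK _ bj.
pose e : 'cV[K]_n := \col_i (if i == j then y else 0).
have be : b *m e = 1%:M.
  apply/matrixP => r s; rewrite !ord1 mxE (bigD1 j) //= big1 ?addr0.
    by rewrite [e _ _]mxE [RHS]mxE !eqxx bjy.
  by move=> i /negPf ij; rewrite [e _ _]mxE ij mulr0.
have [f Nf af] : exists2 f : 'cV_n, N *m f = 0 & a *m f = 1%:M.
  exists (e - G *m N *m e); first by rewrite mulmxBr !mulmxA NGN subrr.
  by rewrite mulmxBr !mulmxA -mulmxBl be.
exists (row_mx f (G - f *m a *m G)).
have XA : row_mx f (G - f *m a *m G) *m col_mx a N = G *m N + f *m b.
  by rewrite mul_row_col mulmxBl /b mulmxBr !mulmxA addrCA.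
rewrite -mulmxA XA mul_col_mx [a *m _]mulmxDr [N *m _]mulmxDr !mulmxA.
rewrite Nf af mul0mx mul1mx NGN.
by rewrite addr0 /b addrC subrK.
Qed.

End InnerInverse.

(** * The system satisfied by the two parts of a dual matrix *)

Section DualSystem.

Variable K : nzRingType.

(** The standard part [X0] must have the form [D0 G + U R] with [U] free; the
    equation left for [X1] then has the right-hand side [D11 - U C11], and its
    consistency is the linear condition [U C11 L = D11 L] on [U].  For a given
    solution one may take [U = X0]. *)
Lemma dual_system_inner (k m n : nat) (C0 C1 : 'M[K]_(m, n))
    (D0 D1 : 'M[K]_(k, n)) (G : 'M[K]_(n, m)) (X0 X1 : 'M[K]_(k, m)) :
  C0 *m G *m C0 = C0 ->
  let L := 1%:M - G *m C0 in
  let R := 1%:M - C0 *m G in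
  let D11 := D1 - D0 *m G *m C1 in
  let C11 := R *m C1 in
  X0 *m C0 = D0 /\ X0 *m C1 + X1 *m C0 = D1 <->
  D0 *m L = 0 /\
  exists U, [/\ U *m (C11 *m L) = D11 *m L, X0 = D0 *m G + U *m R
    & exists U1, X1 = (D11 - U *m C11) *m G + U1 *m R].
Proof.
move=> C0G L R D11 C11.
have X1E U : X0 = D0 *m G + U *m R ->
  X0 *m C1 + X1 *m C0 = D1 <-> X1 *m C0 = D11 - U *m C11.
  move=> X0U; have -> : D11 - U *m C11 = D1 - X0 *m C1.
    by rewrite X0U mulmxDl opprD addrA /C11 mulmxA.
  split=> [<- | ->]; first by rewrite [X0 *m C1 + _]addrC addrK.
  by rewrite addrC subrK.
split=> [[X0C0 X0C1] | [D0L [U [UB3 X0U X1U]]]].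
  have X0U : X0 = D0 *m G + X0 *m R.
    by rewrite /R mulmxBr mulmx1 mulmxA X0C0 addrC subrK.
  have /(mulmx_eq_inner _ _ C0G)[D0L _] := X0C0.
  have /(X1E _ X0U)/(mulmx_eq_inner _ _ C0G)[D1L X1U] := X0C1.
  split=> //; exists X0; split=> //; apply/esym/eqP.
  by rewrite -subr_eq0 mulmxA -mulmxBl D1L.
split; first by apply/(mulmx_eq_inner _ _ C0G); split=> //; exists U.
apply/(X1E _ X0U)/(mulmx_eq_inner _ _ C0G); split=> //.
by rewrite mulmxBl -mulmxA UB3 subrr.
Qed.

Lemma dualmx_surj (m n : nat) (X : 'M[dual K]_(m, n)) :
  exists X0 X1, X = dualmx X0 X1.
Proof.
exists (map_mx (@dstd K) X), (map_mx (@dinf K) X).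
by apply/matrixP => i j; rewrite !mxE; case: (X i j).
Qed.

Lemma dualmx_inj (m n : nat) (A0 A1 B0 B1 : 'M[K]_(m, n)) :
  dualmx A0 A1 = dualmx B0 B1 <-> A0 = B0 /\ A1 = B1.
Proof.
split=> [AB | [-> ->] //].
by split; apply/matrixP => i j; move/matrixP/(_ i j): AB; rewrite !mxE => -[].
Qed.

Lemma mul_dualmx (k m n : nat) (A0 A1 : 'M[K]_(k, m)) (B0 B1 : 'M[K]_(m, n)) :
  dualmx A0 A1 *m dualmx B0 B1 = dualmx (A0 *m B0) (A0 *m B1 + A1 *m B0).
Proof.
apply/matrixP => i j; rewrite !mxE -big_split /=.
elim/big_ind3: _ => // [x1 x2 x3 y1 y2 y3 -> -> // | l _].
by rewrite !mxE.
Qed.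

Lemma dualmx_eq_system (k m n : nat) (C0 C1 : 'M[K]_(m, n))
    (D0 D1 : 'M[K]_(k, n)) (X0 X1 : 'M[K]_(k, m)) :
  dualmx X0 X1 *m dualmx C0 C1 = dualmx D0 D1 <->
  X0 *m C0 = D0 /\ X0 *m C1 + X1 *m C0 = D1.
Proof. by rewrite mul_dualmx; apply: dualmx_inj. Qed.

End DualSystem.

(** * Moore-Penrose inverses of quaternion matrices *)

Section Quaternion.

Variable R : realType.

Implicit Types x y : quat R.

Lemma conj_quatD x y : conj_quat (x + y) = conj_quat x + conj_quat y.
Proof. by congr Quat => /=; rewrite opprD. Qed.

Lemma conj_quatM x y : conj_quat (x * y) = conj_quat y * conj_quat x.
Proof. by case: x y => ? ? ? ? [? ? ? ?]; congr Quat => /=; ring. Qed.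

Lemma conj_quatK : involutive (@conj_quat R).
Proof. by case=> a b c d; rewrite /conj_quat /= !opprK. Qed.

Definition quat_normsq x : R := qre x ^+ 2 + qi x ^+ 2 + qj x ^+ 2 + qk x ^+ 2.

Lemma quat_normsq_ge0 x : 0 <= quat_normsq x.
Proof. by rewrite !addr_ge0 ?sqr_ge0. Qed.

Lemma quat_normsq_eq0 x : quat_normsq x = 0 -> x = 0.
Proof.
case: x => a b c d /eqP; rewrite /quat_normsq /=.
rewrite !paddr_eq0 ?addr_ge0 ?sqr_ge0 //.
by rewrite !sqrf_eq0 => /andP[/andP[/andP[/eqP-> /eqP->] /eqP->] /eqP->].
Qed.

Lemma qre_conjM x : qre (conj_quat x * x) = quat_normsq x.
Proof. by case: x => a b c d; rewrite /quat_normsq /=; ring. Qed.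

Lemma quat_rinv x : x != 0 -> exists y, x * y = 1.
Proof.
move=> xN0; have /eqP : quat_normsq x != 0.
  by apply: contraNneq xN0 => /quat_normsq_eq0->.
case: x xN0 => a b c d _; rewrite /quat_normsq /= => /eqP nN0.
set s := (_ + _ in X in X != 0) in nN0.
exists (Quat (a / s) (- b / s) (- c / s) (- d / s)).
by congr Quat; rewrite /s in nN0 *; field.
Qed.

Lemma ctransmx_mul (m n p : nat) (A : 'M[quat R]_(m, n)) (B : 'M_(n, p)) :
  ctransmx (A *m B) = ctransmx B *m ctransmx A.
Proof.
apply/matrixP => i j; rewrite !mxE.
rewrite (big_morph (@conj_quat R) conj_quatD (_ : _ = 0)); last first.
  by congr Quat; rewrite oppr0.
by apply: eq_bigr => l _; rewrite !mxE conj_quatM.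
Qed.

Lemma ctransmxK (m n : nat) (A : 'M[quat R]_(m, n)) : ctransmx (ctransmx A) = A.
Proof. by apply/matrixP => i j; rewrite !mxE conj_quatK. Qed.

(** The diagonal entries of [A^* A] are sums of squared moduli of entries. *)
Lemma ctransmx_mul_eq0 (m n : nat) (A : 'M[quat R]_(m, n)) :
  ctransmx A *m A = 0 -> A = 0.
Proof.
move=> AA; apply/matrixP => i j; rewrite mxE; apply: quat_normsq_eq0.
have : \sum_l quat_normsq (A l j) = 0.
  transitivity (qre ((ctransmx A *m A) j j)); last by rewrite AA mxE.
  rewrite mxE (big_morph (@qre R) (fun _ _ => erefl) erefl).
  by apply: eq_bigr => l _; rewrite !mxE qre_conjM.
by move/psumr_eq0P => -> // l _; apply: quat_normsq_ge0.
Qed.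

Lemma ctransmx_mulIl (m n p : nat) (A : 'M[quat R]_(m, n)) (Z : 'M_(n, p)) :
  ctransmx A *m (A *m Z) = 0 -> A *m Z = 0.
Proof.
by move=> AAZ; apply: ctransmx_mul_eq0; rewrite ctransmx_mul -mulmxA AAZ mulmx0.
Qed.

(** An inner inverse [G] of the Gram matrix [A^* A] serves: [A^*] can be
    cancelled in [A^* (A G A^* A) = A^* A].  The adjoint of [G] is also an inner
    inverse, and comparing the two shows that [A G A^*] is Hermitian. *)
Lemma exists_least_squares_inverse (m n : nat) (A : 'M[quat R]_(m, n)) :
  exists Y, A *m Y *m A = A /\ ctransmx (A *m Y) = A *m Y.
Proof.
have [G AGA] := exists_inner_inverse (ctransmx A *m A) quat_rinv.
have cancel_gram H :
    ctransmx A *m A *m H *m (ctransmx A *m A) = ctransmx A *m A ->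
    A *m H *m ctransmx A *m A = A.
  move=> AHA; apply/eqP; rewrite -subr_eq0; apply/eqP.
  have E : A *m H *m ctransmx A *m A - A
    = A *m (H *m ctransmx A *m A - 1%:M) by rewrite mulmxBr mulmx1 !mulmxA.
  rewrite E; apply: ctransmx_mulIl; rewrite -E mulmxBr !mulmxA.
  by rewrite !mulmxA in AHA; rewrite AHA subrr.
have AG := cancel_gram _ AGA.
have AG' : A *m ctransmx G *m ctransmx A *m A = A.
  apply: cancel_gram; have := congr1 (@ctransmx R _ _) AGA.
  by rewrite !ctransmx_mul !ctransmxK !mulmxA.
exists (G *m ctransmx A); split; first by rewrite mulmxA.
rewrite !ctransmx_mul ctransmxK.
have AG'T : ctransmx A *m A *m G *m ctransmx A = ctransmx A.
  by have := congr1 (@ctransmx R _ _) AG';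
     rewrite !ctransmx_mul !ctransmxK !mulmxA.
by rewrite -{1}AG'T !mulmxA AG'.
Qed.

(** With [Y] and [Z^*] least-squares inverses of [A] and [A^*], the product
    [Z A Y] satisfies all four Penrose equations. *)
Lemma exists_mpinv (m n : nat) (A : 'M[quat R]_(m, n)) :
  exists X, is_mpinv A X.
Proof.
have [Y [AYA AYh]] := exists_least_squares_inverse A.
have [W [AWA AWh]] := exists_least_squares_inverse (ctransmx A).
pose Z := ctransmx W.
have AZA : A *m Z *m A = A.
  by rewrite -[RHS]ctransmxK -AWA !ctransmx_mul ctransmxK mulmxA.
have ZAh : ctransmx (Z *m A) = Z *m A.
  suff -> : Z *m A = ctransmx A *m W by [].
  by rewrite -AWh ctransmx_mul ctransmxK.
have AX : A *m (Z *m A *m Y) = A *m Y by rewrite !mulmxA AZA.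
have XA : Z *m A *m Y *m A = Z *m A by rewrite -!mulmxA (mulmxA A) AYA.
exists (Z *m A *m Y); split; rewrite ?AX ?XA //.
by rewrite !mulmxA -(mulmxA Z A Z) -(mulmxA Z) AZA.
Qed.

Lemma mul_mpinvK (m n : nat) (A : 'M[quat R]_(m, n)) :
  A *m mpinv A *m A = A.
Proof.
rewrite /mpinv; case: xgetP => [X _ [] // | noX].
by have [X] := exists_mpinv A; move/(_ X): noX.
Qed.

(** * The column rank and the kernel *)

Section Kernel.

Variable n : nat.

(** Freeness in terms of vectors supported on [S], so that it can be compared
    with kernels. *)
Lemma cols_right_freeP (q : nat) (P : 'M[quat R]_(q, n)) (S : {set 'I_n}) :
  cols_right_free P S <->
  forall x : 'cV[quat R]_n, (forall j, j \notin S -> x j 0 = 0) ->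
    P *m x = 0 -> x = 0.
Proof.
split=> [freeS x xS Px | freeS a Pa].
  apply/colP => j; rewrite [RHS]mxE.
  have [jS | /xS //] := boolP (j \in S).
  apply: (freeS (fun i => x i 0)) => // i.
  move/colP/(_ i): Px; rewrite !mxE (bigID [in S]) /=.
  by rewrite [X in _ + X]big1 ?addr0 // => l /xS ->; rewrite mulr0.
move=> j jS; pose x : 'cV_n := \col_i (if i \in S then a i else 0).
have /colP/(_ j) : x = 0; last by rewrite !mxE jS.
apply: freeS => [i /negPf iS | ]; first by rewrite mxE iS.
apply/colP => i; rewrite !mxE -[RHS](Pa i) [RHS]big_mkcond.
by apply: eq_bigr => l _; rewrite mxE; case: ifP; rewrite ?mulr0.
Qed.

Lemma leq_card_qrank (q : nat) (P : 'M[quat R]_(q, n)) (S : {set 'I_n}) :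
  cols_right_free P S -> (#|S| <= qrank P)%N.
Proof.
move=> /asboolP freeS; rewrite /qrank.
exact: (@leq_bigmax_cond _ (fun S => `[< cols_right_free P S >])
  (fun S : {set 'I_n} => #|S|)).
Qed.

Lemma qrank_witness (q : nat) (P : 'M[quat R]_(q, n)) :
  exists2 S : {set 'I_n}, cols_right_free P S & #|S| = qrank P.
Proof.
have free0 : `[< cols_right_free P finset.set0 >].
  by apply/asboolP => a _ j; rewrite inE.
rewrite /qrank (bigmax_eq_arg _ free0).
by case: arg_maxnP => // S /asboolP freeS _; exists S.
Qed.

(** By maximality any further column is a right combination of those in [S];
    this is where division is used, by the coefficient of that column. *)
Lemma free_card_span (q : nat) (P : 'M[quat R]_(q, n)) (S : {set 'I_n}) :
  cols_right_free P S -> #|S| = qrank P ->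
  forall x : 'cV[quat R]_n,
  exists2 y : 'cV_n, forall j, j \notin S -> y j 0 = 0 & P *m x = P *m y.
Proof.
move=> /cols_right_freeP freeS cardS.
have spanj j : exists t : 'cV[quat R]_n,
    (forall i, i \notin S -> t i 0 = 0) /\ P *m t = col j P.
  have [jS | jS] := boolP (j \in S).
    exists (delta_mx j 0); split=> [i iS | ]; last by rewrite colE.
    by rewrite mxE eqxx andbT; case: eqP iS => // ->; rewrite jS.
  have nfree : ~ cols_right_free P (j |: S).
    by move=> /leq_card_qrank; rewrite -cardS cardsU1 jS ltnn.
  have [x [xS Px xN0]] : exists x : 'cV[quat R]_n,
      [/\ forall i, i \notin j |: S -> x i 0 = 0, P *m x = 0 & x <> 0].
    apply: contrapT => nox; apply: nfree; apply/cols_right_freeP => x xS Px.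
    by apply: contrapT => xN0; apply: nox; exists x.
  (* If [x j] were zero, [x] would be a relation between the columns in [S]. *)
  have xj : x j 0 != 0.
    apply/eqP => xj0; apply: xN0; apply: freeS => // i iS.
    have [-> //| ij] := eqVneq i j.
    by apply: xS; rewrite !inE negb_or ij.
  have [y xjy] := quat_rinv xj.
  exists (delta_mx j 0 - x *m y%:M); split=> [i iS | ]; last first.
    by rewrite mulmxBr mulmxA Px mul0mx subr0 colE.
  rewrite !mxE eqxx andbT big_ord1 !mxE eqxx mulr1n.
  have [-> | ij] := eqVneq i j; first by rewrite xjy subrr.
  by rewrite xS ?mul0r ?subr0 // !inE negb_or ij.
have [t tP] := fin_all_exists spanj.
move=> x; pose T := \matrix_(i, j) t j i 0.
have PT : P *m T = P.
  apply/matrixP => i j; have [_ /colP/(_ i)] := tP j; rewrite !mxE => <-.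
  by apply: eq_bigr => l _; rewrite mxE.
exists (T *m x); last by rewrite mulmxA PT.
move=> i iS; rewrite mxE big1 // => j _.
by rewrite mxE (proj1 (tP j) _ iS) mul0r.
Qed.

Lemma cols_right_free_ker (m p : nat) (M : 'M[quat R]_(m, n))
    (N : 'M[quat R]_(p, n)) (S : {set 'I_n}) :
  (forall x : 'cV_n, N *m x = 0 -> M *m x = 0) ->
  cols_right_free M S -> cols_right_free N S.
Proof.
move=> kerNM /cols_right_freeP freeS; apply/cols_right_freeP => x xS /kerNM.
exact: freeS.
Qed.

Lemma leq_qrank_ker (m p : nat) (M : 'M[quat R]_(m, n))
    (N : 'M[quat R]_(p, n)) :
  (forall x : 'cV_n, N *m x = 0 -> M *m x = 0) -> (qrank M <= qrank N)%N.
Proof.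
move=> kerNM; have [S freeS <-] := qrank_witness M.
exact/leq_card_qrank/cols_right_free_ker/freeS.
Qed.

(** A maximal free set of columns of [M] stays free for [N], hence is maximal
    there too when the ranks agree.  Modulo the kernel of [N] every vector is
    then supported on that set, where [M] is injective. *)
Lemma qrank_eq_ker (m p : nat) (M : 'M[quat R]_(m, n))
    (N : 'M[quat R]_(p, n)) :
  (forall x : 'cV_n, N *m x = 0 -> M *m x = 0) ->
  qrank N = qrank M <-> forall x : 'cV_n, M *m x = 0 -> N *m x = 0.
Proof.
move=> kerNM; split=> [rkNM x Mx | kerMN]; last first.
  by apply/eqP; rewrite eqn_leq !leq_qrank_ker.
have [S freeS cardS] := qrank_witness M.
have freeNS := cols_right_free_ker kerNM freeS.
have [|y yS Nxy] := free_card_span freeNS _ x; first by rewrite cardS.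
rewrite Nxy; suff -> : y = 0 by rewrite mulmx0.
move/cols_right_freeP: freeS; apply=> //.
have -> : M *m y = M *m (y - x) by rewrite mulmxBr Mx subr0.
by apply: kerNM; rewrite mulmxBr Nxy subrr.
Qed.

(** The columns of [I - M^+ M] lie in the kernel of [M].  When [N] vanishes on
    that kernel, [N (I - M^+ M) = 0], that is, [N = (N M^+) M]. *)
Lemma ker_sub_mulmx (m p : nat) (M : 'M[quat R]_(m, n))
    (N : 'M[quat R]_(p, n)) :
  (forall x : 'cV_n, M *m x = 0 -> N *m x = 0) <-> exists Y, Y *m M = N.
Proof.
split=> [kerMN | [Y <-] x Mx]; last by rewrite -mulmxA Mx mulmx0.
exists (N *m mpinv M); apply/esym/eqP; rewrite -subr_eq0 -mulmxA.
rewrite -{1}[N]mulmx1 -mulmxBr; apply/eqP/matrixP => i j.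
have /colP/(_ i) : N *m col j (1%:M - mpinv M *m M) = 0.
  apply: kerMN; rewrite colE mulmxA mulmxBr mulmx1 mulmxA mul_mpinvK subrr.
  by rewrite mul0mx.
by rewrite colE mulmxA -colE !mxE.
Qed.

(** Meant for an [N] made of the rows of [M] and of [B].  Describing [N] by its
    kernel makes the order of the rows irrelevant, so that the rows of [B] may be
    inserted between those of [M]. *)
Lemma qrank_append_rows (m p q : nat) (M : 'M[quat R]_(m, n))
    (B : 'M[quat R]_(p, n)) (N : 'M[quat R]_(q, n)) :
  (forall x : 'cV_n, N *m x = 0 <-> M *m x = 0 /\ B *m x = 0) ->
  qrank N = qrank M <-> exists Y, Y *m M = B.
Proof.
move=> kerN; apply: iff_trans (ker_sub_mulmx _ _).
apply: iff_trans (qrank_eq_ker _) _ => [x /kerN[] // | ].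
split=> ker x Mx; first by have /kerN[] := ker x Mx.
by apply/kerN; split; last exact: ker.
Qed.

End Kernel.

End Quaternion.

Theorem corollary3p4 (R : realType) (k m n : nat)
    (C0 C1 : 'M[quat R]_(m, n)) (D0 D1 : 'M[quat R]_(k, n)) :
  let C : 'M[dual (quat R)]_(m, n) := dualmx C0 C1 in
  let D : 'M[dual (quat R)]_(k, n) := dualmx D0 D1 in
  let D11 := D1 - D0 *m mpinv C0 *m C1 in
  let C11 := Rproj C0 *m C1 in
  let B3 := C11 *m Lproj C0 in
  let C3 := D11 *m Lproj C0 in
  let solvable := exists X : 'M[dual (quat R)]_(k, m), X *m C = D in
  let projection_cond := D0 *m Lproj C0 = 0 /\ C3 *m Lproj B3 = 0 in
  let rank_cond :=
    qrank (col_mx C0 D0) = qrank C0 /\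
    qrank (col_mx (row_mx C0 0) (col_mx (row_mx D1 D0) (row_mx C1 C0)))
      = qrank (col_mx (row_mx C0 0) (row_mx C1 C0)) in
  [/\ solvable <-> projection_cond,
      solvable <-> rank_cond
    & solvable ->
      forall X : 'M[dual (quat R)]_(k, m),
        X *m C = D <->
        exists U1 U2 : 'M[quat R]_(k, m),
          let U := C3 *m mpinv B3 + U2 *m Rproj B3 in
          let X0 := D0 *m mpinv C0 + U *m Rproj C0 in
          let X1 := (D11 - U *m C11) *m mpinv C0 + U1 *m Rproj C0 in
          X = dualmx X0 X1].
Proof.
move=> C D D11 C11 B3 C3 solvable projection_cond rank_cond.
have B3K := mul_mpinvK B3.
have solP X0 X1 : dualmx X0 X1 *m C = D <-> D0 *m Lproj C0 = 0 /\
    exists U, [/\ U *m B3 = C3, X0 = D0 *m mpinv C0 + U *m Rproj C0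
      & exists U1, X1 = (D11 - U *m C11) *m mpinv C0 + U1 *m Rproj C0].
  exact: iff_trans (dualmx_eq_system _ _ _ _ _ _)
    (dual_system_inner _ _ _ _ _ (mul_mpinvK C0)).
have sol_proj : solvable <-> projection_cond.
  split=> [[X] | [D0L C3L]].
    have [X0 [X1 ->]] := dualmx_surj X.
    move=> /solP[D0L [U [/(mulmx_eq_inner _ _ B3K)[C3L _] _ _]]].
    by split.
  (* The general solution at [U1 = U2 = 0]. *)
  pose U := C3 *m mpinv B3.
  exists (dualmx (D0 *m mpinv C0 + U *m Rproj C0)
    ((D11 - U *m C11) *m mpinv C0 + 0 *m Rproj C0)).
  apply/solP; split=> //; exists U; split=> //; last by exists 0.
  by apply/(mulmx_eq_inner _ _ B3K); split=> //; exists 0; rewrite mul0mx addr0.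
have rank0 : qrank (col_mx C0 D0) = qrank C0 <-> exists Y, Y *m C0 = D0.
  apply: qrank_append_rows => x; rewrite mul_col_mx.
  split=> [/eqP | [-> ->]]; last by rewrite col_mx0.
  by rewrite col_mx_eq0 => /andP[/eqP-> /eqP->].
have rank1 : qrank (col_mx (row_mx C0 0) (col_mx (row_mx D1 D0) (row_mx C1 C0)))
      = qrank (col_mx (row_mx C0 0) (row_mx C1 C0)) <->
    exists Y, Y *m col_mx (row_mx C0 0) (row_mx C1 C0) = row_mx D1 D0.
  apply: qrank_append_rows => x; rewrite !mul_col_mx; split=> [/eqP | []].
    by rewrite !col_mx_eq0 => /and3P[/eqP-> /eqP-> /eqP->]; rewrite col_mx0.
  by move/eqP; rewrite col_mx_eq0 => /andP[/eqP-> /eqP->] ->; rewrite !col_mx0.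
have sol_rank : solvable <-> rank_cond.
  split=> [[X] | [_ /rank1[Y]]].
    have [X0 [X1 ->]] := dualmx_surj X.
    move=> /dualmx_eq_system[X0C0 X0C1].
    split; first by apply/rank0; exists X0.
    apply/rank1; exists (row_mx X1 X0).
    by rewrite mul_row_col !mul_mx_row mulmx0 add_row_mx add0r X0C0 addrC X0C1.
  rewrite -[Y]hsubmxK mul_row_col !mul_mx_row mulmx0 add_row_mx add0r.
  move=> /eq_row_mx[XC1 XC0]; exists (dualmx (rsubmx Y) (lsubmx Y)).
  by apply/dualmx_eq_system; rewrite addrC.
split=> // /sol_proj[D0L C3L] X; split=> [ | [U1 [U2 ->]]].
  have [X0 [X1 ->]] := dualmx_surj X.
  move=> /solP[_ [U [/(mulmx_eq_inner _ _ B3K)[_ [U2 ->]] -> [U1 ->]]]].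
  by exists U1, U2.
apply/solP; split=> //; eexists; split; [ | reflexivity | by exists U1].
by apply/(mulmx_eq_inner _ _ B3K); split=> //; exists U2.
Qed.
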